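(* Let $(V,P)$ be a mixing Markov chain. With $m_n^*$ the maximal expected meeting time and $\overline{m}_n$ the stationary expected meeting time of two independent walkers on the associated $n$-block chain $(V_n,P_n)$, and $L(V,P)=-\log\lambda$, $$\lim_{n\to\infty}\frac1n\log m_n^*=\lim_{n\to\infty}\frac1n\log\overline{m}_n=L(V,P).$$
   Context: A Markov chain $(V,P)$ consists of a finite set $V$ and a stochastic transition matrix $P$ indexed by $V$; it is mixing if $P^k>0$ entrywise for some $k\ge1$. Let $\pi$ be its unique stationary distribution. For a word $u=u_1\cdots u_n\in V^n$ put $\mu(u)=\pi(u_1)\prod_{j=1}^{n-1}P(u_j,u_{j+1})$. The $n$-block chain $(V_n,P_n)$ associated to $(V,P)$ has state space $V_n=\{u\in V^n:\mu(u)>0\}$ and transition matrix $P_n(u,v)=P(u_n,v_n)$ if $u_2\cdots u_n=v_1\cdots v_{n-1}$, and $P_n(u,v)=0$ otherwise. It is again mixing, with stationary distribution $\pi_n(u)=\mu(u)$. For $u,v\in V_n$, $m_n(u,v)$ is the first time at which two independent random walkers on $(V_n,P_n)$, started at $u$ and $v$ respectively, occupy the same state. Times are counted starting from $1$, i.e. the initial positions are the positions at time $1$ (so $m_n(u,u)=1$). Define $$m_n^*=\max_{u,v\in V_n}\mathbb{E}(m_n(u,v)),\qquad \overline{m}_n=\sum_{u,v\in V_n}\pi_n(u)\pi_n(v)\,\mathbb{E}(m_n(u,v)).$$ Let $Q$ be the $|V|\times|V|$ matrix with $Q(u,v)=P(u,v)^2$, let $\lambda$ be its Perron eigenvalue (spectral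 radius), and $L(V,P)=-\log\lambda$ (natural logarithm). *)

(* Defs.v *)
From HB Require Import structures.
From mathcomp Require Export all_boot all_order all_algebra.
From mathcomp Require Export complex.
From mathcomp Require Export all_classical all_reals all_analysis.

Set Implicit Arguments.
Unset Strict Implicit.
Unset Printing Implicit Defensive.
Import Order.TTheory GRing.Theory Num.Theory.
Import numFieldNormedType.Exports.

Local Open Scope classical_set_scope.
Local Open Scope ring_scope.

Section MarkovChain.
Context {R : realType} {V : finType}.
Implicit Types (P : V -> V -> R) (pi : V -> R).

Definition stochastic P : Prop :=
  (forall u v, 0 <= P u v) /\ (forall u, \sum_v P u v = 1).

Definition kernel_mx P : 'M[R]_#|V| :=
  \matrix_(i, j) P (enum_val i) (enum_val j).

Definition mixing P : Prop :=
  exists2 k : nat, (0 < k)%N & forall i j, 0 < (kernel_mx P ^+ k) i j.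

Definition stationary P pi : Prop :=
  [/\ forall v, 0 <= pi v, \sum_v pi v = 1
    & forall v, \sum_u pi u * P u v = pi v].

(* Words are indexed from 0, and the parameter n stands for words of length
   n.+1: u_1 ... u_{n+1} is tnth u 0, ..., tnth u n.  For j < n,
   [lower j] is position j and [upper j] is position j + 1. *)
Definition lower n (j : 'I_n) : 'I_n.+1 := widen_ord (leqnSn n) j.
Definition upper n (j : 'I_n) : 'I_n.+1 := lift ord0 j.

Definition word_measure P pi n (u : n.+1.-tuple V) : R :=
  pi (tnth u ord0) * \prod_(j < n) P (tnth u (lower j)) (tnth u (upper j)).

(* The states of the (n+1)-block chain. *)
Definition block P pi n := {u : n.+1.-tuple V | 0 < word_measure P pi u}.

Definition block_trans P pi n (u v : block P pi n) : R :=
  if [forall j : 'I_n, tnth (val u) (upper j) == tnth (val v) (lower j)]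
  then P (tnth (val u) ord_max) (tnth (val v) ord_max) else 0.

Definition block_stationary P pi n (u : block P pi n) : R :=
  word_measure P pi (val u).

End MarkovChain.

(* Complex eigenvalues are needed: a real matrix may have no real one. *)
Definition spectral_radius {R : realType} n (A : 'M[R]_n) : R :=
  sup [set r | exists2 a : R[i],
         eigenvalue (map_mx (real_complex R) A) a & r = ComplexField.Normc.normc a].

Definition Lrate {R : realType} {V : finType} (P : V -> V -> R) : R :=
  - ln (spectral_radius (kernel_mx (fun u v => P u v ^+ 2))).

Section RandomWalkers.
Context {R : realType} {d : measure_display} {Omega : measurableType d}.
Variable Pr : probability Omega R.
Context {T : finType}.
Implicit Types (X Y : nat -> Omega -> T) (x y : nat -> T).

(* The event that the first k positions of X are x 0, ..., x k.-1. *)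
Definition cylinder X k x : set Omega :=
  [set w | forall i, (i < k)%N -> X i w = x i].

(* X is a Markov chain with transition matrix P started at u; X k is the
   position at time k + 1.  [walk_step] is the Markov property
     Pr (X_{k+1} = x_{k+1} | X_0 = x_0, ..., X_k = x_k) = P x_k x_{k+1},
   multiplied by the probability of the conditioning event. *)
Record random_walk (P : T -> T -> R) (u : T) X : Prop := RandomWalk {
  walk_measurable : forall k z, measurable [set w | X k w = z];
  walk_start : Pr [set w | X 0%N w = u] = 1%E;
  walk_step : forall k x,
    Pr (cylinder X k.+2 x)
    = (Pr (cylinder X k.+1 x) * (P (x k) (x k.+1))%:E)%E }.

(* Cylinders are a pi-system generating the sigma-algebra of a process with
   finitely many states, so this is independence of the two processes. *)
Definition independent_processes X Y : Prop := forall k l x y,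
  Pr (cylinder X k x `&` cylinder Y l y)
  = (Pr (cylinder X k x) * Pr (cylinder Y l y))%E.

Definition independent_walkers (P : T -> T -> R) (u v : T) X Y : Prop :=
  [/\ random_walk P u X, random_walk P v Y & independent_processes X Y].

(* The infimum is +oo if the walkers never meet; the initial time is 1. *)
Definition meeting_time X Y (w : Omega) : \bar R :=
  ereal_inf [set k.+1%:R%:E | k in [set k | X k w = Y k w]].

Definition expected_meeting_time X Y : \bar R :=
  (\int[Pr]_w meeting_time X Y w)%E.

End RandomWalkers.

(* Below, m u v is the expected meeting time from the states u and v. *)
Definition max_meeting_time {R : realType} {T : finType} (m : T -> T -> \bar R)
    : \bar R :=
  \big[Order.max/-oo%E]_(p : T * T) m p.1 p.2.

Definition mean_meeting_time {R : realType} {T : finType} (pi : T -> R)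
    (m : T -> T -> \bar R) : \bar R :=
  (\sum_u \sum_v (pi u * pi v)%:E * m u v)%E.

(* Main.v *)
(* Two walkers on the n-block chain occupy the same state exactly when their
   last n letters agree, and two independent copies of the chain follow a common
   word with total weight [1^T Q^(n-1) 1], which by Perron-Frobenius is of order
   [lam^n].

   Upper bound: by mixing, from any pair of states the walkers show the same last
   letter after k steps with probability bounded below, and then agree for n - 1
   more letters with probability of order [lam^n].  So each time window of length
   n + k gives a chance of order [lam^n] to meet, and the expected meeting time
   is at most of order [n lam^(-n)].

   Lower bound: started from the stationary distribution, at any fixed time the
   walkers coincide with probability S, the sum of the squares of the stationary
   weights, which is of order at most [lam^n].  By the union bound they have not
   met before time 1/(2S) with probability at least 1/2, so the mean meeting time
   is at least 1/(4S). *)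

Require Import Defs.
From mathcomp Require Import ring lra zify.

Set Implicit Arguments.
Unset Strict Implicit.
Unset Printing Implicit Defensive.
Import Order.TTheory GRing.Theory Num.Theory.
Import numFieldNormedType.Exports.

Local Open Scope classical_set_scope.
Local Open Scope ring_scope.

(** * Perron vectors *)

Lemma finite_domination (R : realFieldType) (I : finType) (a b : I -> R) :
  (forall i, 0 < b i) -> exists2 C, 0 < C & forall i, a i <= C * b i.
Proof.
move=> b0.
have h i : 0 <= `|a i| / b i by rewrite divr_ge0// ltW.
exists (1 + \sum_i `|a i| / b i); first by rewrite ltr_pwDl// sumr_ge0.
move=> i; rewrite -ler_pdivrMr// (le_trans (ler_norm _))// normrM.
rewrite (bigD1 i)//= (gtr0_norm (_ : 0 < (b i)^-1)) ?invr_gt0//.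
by rewrite addrCA lerDl addr_ge0// sumr_ge0.
Qed.

Section Perron.
Context {R : realType}.

Lemma mulmx_row_gt0 n (y : 'rV[R]_n) (B : 'M[R]_n) :
  (forall i, 0 <= y ord0 i) -> y != 0 -> (forall i j, 0 < B i j) ->
  forall j, 0 < (y *m B) ord0 j.
Proof.
move=> y0 yN0 B0 j; rewrite mxE lt_neqAle eq_sym.
rewrite sumr_ge0 ?andbT => [|i _]; last by rewrite mulr_ge0// ltW.
rewrite psumr_neq0 => [|i _]; last by rewrite mulr_ge0// ltW.
move/matrix0Pn : yN0 => [k [i yi]]; apply/hasP; exists i.
  by rewrite mem_index_enum.
by rewrite /= mulr_gt0// lt_neqAle eq_sym y0 andbT; move: yi; rewrite ord1.
Qed.

Lemma mx_expn_ge0 n (A : 'M[R]_n) k :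
  (forall i j, 0 <= A i j) -> forall i j, 0 <= (A ^+ k) i j.
Proof.
move=> A0; elim: k => [|k ih] i j; first by rewrite expr0 mxE ler0n.
by rewrite exprS mxE sumr_ge0// => l _; rewrite mulr_ge0.
Qed.

(** For nonnegative matrices, only the zero pattern decides which entries of a power are positive.
    This carries mixing over from [P] to the matrix of squared entries. *)
Lemma mx_expn_gt0 n (A B : 'M[R]_n) k :
  (forall i j, 0 <= A i j) -> (forall i j, 0 <= B i j) ->
  (forall i j, 0 < A i j -> 0 < B i j) ->
  forall i j, 0 < (A ^+ k) i j -> 0 < (B ^+ k) i j.
Proof.
move=> A0 B0 AB; elim: k => [|k ih] i j; first by rewrite !expr0 !mxE.
rewrite !exprS !mxE !lt_neqAle !sumr_ge0 ?andbT; last 2 first.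
- by move=> l _; rewrite mulr_ge0// mx_expn_ge0.
- by move=> l _; rewrite mulr_ge0// mx_expn_ge0.
rewrite ![0 == _]eq_sym !psumr_neq0; last 2 first.
- by move=> l _; rewrite mulr_ge0// mx_expn_ge0.
- by move=> l _; rewrite mulr_ge0// mx_expn_ge0.
move=> /hasP[l lin /= l0]; apply/hasP; exists l => //=.
have Ail : 0 < A i l.
  by rewrite lt_neqAle A0 andbT eq_sym; apply: contraTneq l0 => ->; rewrite mul0r ltxx.
by rewrite mulr_gt0 ?AB// ih// -(pmulr_rgt0 _ Ail).
Qed.

(* [z] is a point [x] of the simplex together with a number [r] such that
   [r x <= x A]; the Perron root is the largest such [r]. *)
Definition collatz n (A : 'M[R]_n) : set ('rV[R]_n * R) :=
  [set z : 'rV[R]_n * R | [/\ forall i, 0 <= z.1 ord0 i, \sum_i z.1 ord0 i = 1, 0 <= z.2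
    & forall i, z.2 * z.1 ord0 i <= (z.1 *m A) ord0 i]].

Lemma collatz_compact n (A : 'M[R]_n) :
  (forall i j, 0 <= A i j) -> compact (collatz A).
Proof.
move=> A0.
(* Upper bound for [r]: sum [r * x_i <= (x A)_i] over [i], where the [x_i] sum to 1 and are at most
   1. *)
pose B := \sum_i \sum_j A i j.
pose cube : set 'rV[R]_n := [set x | forall i, `[0, 1]%classic (x ord0 i)].
pose box : set ('rV[R]_n * R) := cube `*` `[0, B]%classic.
have box_compact : compact box.
  apply: compact_setX; last exact: segment_compact.
  apply: (@rV_compact R^o n (fun=> `[0, 1]%classic)) => i.
  exact: segment_compact.
have coordc i : continuous (fun z : 'rV[R]_n * R => z.1 ord0 i).
  move=> z; apply: (@continuous_comp _ _ _ fst (fun x : 'rV[R]_n => x ord0 i)).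
    exact: cvg_fst.
  exact: coord_continuous.
have sumc (c : 'I_n -> R) : continuous (fun z : 'rV[R]_n * R => \sum_i z.1 ord0 i * c i).
  apply: (continuous_big (op := +%R)); first exact: add_continuous.
  by move=> i _ z; apply: cvgM; [exact: coordc|exact: cvg_cst].
(* The factor 1 puts the simplex condition in the form covered by [sumc]. *)
pose C0 := [set z : 'rV[R]_n * R | \sum_i z.1 ord0 i * 1 = 1].
pose C i := [set z : 'rV[R]_n * R | 0 <= \sum_j z.1 ord0 j * A j i - z.2 * z.1 ord0 i].
have C0closed : closed C0.
  apply: (preimage_closed (f := fun z : 'rV[R]_n * R => \sum_i z.1 ord0 i * 1)
    (D := [set x | x = 1])).
    by move=> z _; exact: sumc.
  exact: closed_eq.
have Cclosed i : closed (C i).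
  apply: (preimage_closed (f := fun z : 'rV[R]_n * R =>
    \sum_j z.1 ord0 j * A j i - z.2 * z.1 ord0 i) (D := [set x | 0 <= x])).
    move=> z _; apply: cvgB; first exact: sumc.
    by apply: cvgM; [exact: cvg_snd|exact: coordc].
  exact: closed_ge.
have -> : collatz A = box `&` (C0 `&` \bigcap_i C i).
  apply/seteqP; split=> [[x r] [/= x0 x1 r0 xr]|[x r]].
    have xle1 i : x ord0 i <= 1.
      by rewrite -x1 (bigD1 i)//= lerDl sumr_ge0.
    split; last first.
      split; first by rewrite /C0/=; under eq_bigr do rewrite mulr1.
      by move=> i _; rewrite /C/= subr_ge0; have := xr i; rewrite mxE.
    split; first by move=> i; rewrite /= in_itv/= x0 xle1.
    rewrite /= in_itv/= r0 /= -[r]mulr1 -x1 mulr_sumr.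
    apply: (@le_trans _ _ (\sum_i (x *m A) ord0 i)); first exact: ler_sum.
    under eq_bigr do rewrite mxE.
    rewrite exchange_big; apply: ler_sum => i _; apply: ler_sum => j _ /=.
    by rewrite ler_piMl.
  move=> [[/= cx cr] [c0 c]]; split => /=.
  - by move=> i; have := cx i; rewrite /= in_itv/= => /andP[].
  - by move: c0; rewrite /C0/=; under eq_bigr do rewrite mulr1.
  - by move: cr; rewrite /= in_itv/= => /andP[].
  - by move=> i; have := c i I; rewrite /C/= subr_ge0 mxE.
by apply: compact_closedI => //; apply: closedI => //; exact: closed_bigI.
Qed.

(** Collatz-Wielandt: maximize [r] over the compact set [collatz A]. Were [x A] different from
    [r x], multiplying the slack by the positive matrix [A ^+ k] would make it strict in every
    coordinate and leave room for a larger [r]. *)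
Lemma perron_left n (A : 'M[R]_n) k : (0 < n)%N -> (0 < k)%N ->
  (forall i j, 0 <= A i j) -> (forall i j, 0 < (A ^+ k) i j) ->
  exists lam : R, exists2 x : 'rV[R]_n,
    0 < lam /\ (forall i, 0 < x ord0 i) & x *m A = lam *: x.
Proof.
move=> n0 k0 A0 Ak.
have E0 : collatz A !=set0.
  pose i0 := Ordinal n0; exists (\row_i (i == i0)%:R, 0); split => //=.
  - by move=> i; rewrite mxE ler0n.
  - rewrite (bigD1 i0)//= mxE eqxx big1 ?addr0// => i /negbTE ii0.
    by rewrite mxE ii0.
  - move=> i; rewrite mul0r mxE sumr_ge0// => j _; rewrite mxE.
    by rewrite mulr_ge0.
have [|[x r] /set_mem[/= x0 x1 r0 xr] xmax] :=
  compact_EVT_max E0 (collatz_compact A0) (f := snd).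
  by apply: continuous_subspaceT => z; exact: cvg_snd.
have xN0 : x != 0.
  apply: contra_eq_neq x1 => ->.
  by under eq_bigr do rewrite mxE; rewrite big1// eq_sym oner_eq0.
have x'0 := mulmx_row_gt0 x0 xN0 Ak.
set x' := x *m A ^+ k in x'0.
have s0 : 0 < \sum_i x' ord0 i.
  rewrite (bigD1 (Ordinal n0))//= ltr_pwDl// sumr_ge0// => i _.
  exact: ltW.
have xA : x *m A = r *: x.
  apply/eqP; rewrite -subr_eq0; apply/negPn/negP => yN0.
  have y0 i : 0 <= (x *m A - r *: x) ord0 i.
    by rewrite !mxE subr_ge0; have := xr i; rewrite mxE.
  have y'0 := mulmx_row_gt0 y0 yN0 Ak.
  have y'E : (x *m A - r *: x) *m A ^+ k = x' *m A - r *: x'.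
    have AC : A *m A ^+ k = A ^+ k *m A.
      by rewrite -[LHS]/(A * A ^+ k) -exprS exprSr.
    by rewrite mulmxBl -scalemxAl -!mulmxA AC.
  (* [C^-1] times [x'] fits under the strict slack, so the normalized [x'] admits [r + C^-1],
     against maximality. *)
  have [C C0 x'C] := finite_domination (x' ord0) y'0.
  pose s := \sum_i x' ord0 i.
  have : collatz A (s^-1 *: x', r + C^-1).
    split => /=.
    - by move=> i; rewrite mxE mulr_ge0// ltW// invr_gt0.
    - by under eq_bigr do rewrite mxE; rewrite -mulr_sumr mulVf// gt_eqF.
    - by rewrite addr_ge0// ltW// invr_gt0.
    - move=> i; rewrite -scalemxAl !mxE mulrCA ler_pM2l ?invr_gt0//.
      rewrite mulrDl -lerBrDl mulrC ler_pdivrMr// mulrC.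
      by have := x'C i; rewrite y'E !mxE.
  move=> /mem_set/xmax/=.
  by rewrite leNgt ltrDl invr_gt0 C0.
have x'E m : x *m A ^+ m = r ^+ m *: x.
  elim: m => [|m ih]; first by rewrite !expr0 mulmx1 scale1r.
  by rewrite exprSr [_ * A]/(_ *m A) mulmxA ih -scalemxAl xA scalerA -exprSr.
have rx i : 0 < r ^+ k * x ord0 i by have := x'0 i; rewrite /x' x'E mxE.
have rk0 : 0 < r ^+ k.
  rewrite lt_neqAle exprn_ge0// andbT eq_sym; apply: contraTneq (rx (Ordinal n0)) => ->.
  by rewrite mul0r ltxx.
have xp i : 0 < x ord0 i by rewrite -(pmulr_rgt0 _ rk0).
have rp : 0 < r.
  rewrite lt_neqAle r0 andbT eq_sym; apply: contraTneq rk0 => ->.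
  by rewrite expr0n gtn_eqF// ltxx.
by exists r, x.
Qed.

Lemma trmx_expn n (A : 'M[R]_n) k : (A ^+ k)^T = A^T ^+ k.
Proof.
elim: k => [|k ih]; first by rewrite !expr0 trmx1.
by rewrite exprS exprSr -[A * _]/(A *m _) trmx_mul ih.
Qed.

(** The right vector is a left vector of the transpose. Evaluating [x A h] in two ways identifies
    the two eigenvalues, since [x h] is positive. *)
Lemma perron n (A : 'M[R]_n) k : (0 < n)%N -> (0 < k)%N ->
  (forall i j, 0 <= A i j) -> (forall i j, 0 < (A ^+ k) i j) ->
  exists lam : R, exists x : 'rV[R]_n, exists h : 'cV[R]_n,
    [/\ 0 < lam, forall i, 0 < x ord0 i, forall i, 0 < h i ord0,
        x *m A = lam *: x & A *m h = lam *: h].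
Proof.
move=> n0 k0 A0 Ak.
have [lam [x [lam0 x0] xA]] := perron_left n0 k0 A0 Ak.
have [||mu [y [mu0 y0] yA]] := @perron_left n A^T k n0 k0.
- by move=> i j; rewrite mxE.
- by move=> i j; rewrite -trmx_expn mxE.
have Ah : A *m y^T = mu *: y^T.
  by rewrite -[A]trmxK -trmx_mul yA linearZ.
exists lam, x, y^T; split => //; first by move=> i; rewrite mxE.
have : x *m A *m y^T = x *m (A *m y^T) by rewrite mulmxA.
rewrite xA Ah -scalemxAl -scalemxAr => /(congr1 (fun M : 'M[R]_1 => M ord0 ord0)).
rewrite !mxE => /mulIf -> //.
rewrite gt_eqF// (bigD1 (Ordinal n0))//= ltr_pwDl ?mxE ?mulr_gt0//.
by rewrite sumr_ge0// => i _; rewrite mxE mulr_ge0// ltW.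
Qed.

(** * The Perron root as spectral radius *)

Lemma normc_ge0 (z : R[i]) : 0 <= ComplexField.Normc.normc z.
Proof. by case: z => a b; exact: sqrtr_ge0. Qed.

Lemma normc_sum (I : finType) (f : I -> R[i]) :
  ComplexField.Normc.normc (\sum_i f i) <= \sum_i ComplexField.Normc.normc (f i).
Proof.
elim/big_ind2 : _ => [|z a y b za yb|//].
  by rewrite ComplexField.Normc.normc0.
by rewrite (le_trans (le_normcD _ _))// lerD.
Qed.

Lemma normc_real (a : R) : 0 <= a -> ComplexField.Normc.normc (real_complex R a) = a.
Proof. by move=> a0; rewrite /= expr0n /= addr0 sqrtr_sqr ger0_norm. Qed.

(** The vector [x] makes [lam] an eigenvalue. For a complex eigenvector [v] with eigenvalue [a], the
    moduli satisfy [|a| |v_j| <= sum_i |v_i| A i j]; pairing with the positive vector [h] gives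
    [|a| <= lam]. *)
Lemma spectral_radius_eq n (A : 'M[R]_n) (lam : R) (x : 'rV[R]_n) (h : 'cV[R]_n) :
  (forall i j, 0 <= A i j) -> 0 <= lam -> x != 0 -> (forall i, 0 < h i ord0) ->
  x *m A = lam *: x -> A *m h = lam *: h ->
  spectral_radius A = lam.
Proof.
move=> A0 lam0 xN0 h0 xA Ah; rewrite /spectral_radius.
set S := (X in sup X).
have Slam : S lam.
  exists (real_complex R lam); last by rewrite normc_real.
  apply/eigenvalueP; exists (map_mx (real_complex R) x).
    by rewrite -map_mxM xA map_mxZ.
  by rewrite map_mx_eq0.
have Sub : ubound S lam.
  move=> _ [a /eigenvalueP[v vA vN0] ->].
  pose z i := ComplexField.Normc.normc (v ord0 i).
  have z0 i : 0 <= z i by exact: normc_ge0.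
  have az j : ComplexField.Normc.normc a * z j <= \sum_i z i * A i j.
    rewrite -ComplexField.Normc.normcM.
    have := congr1 (fun M : 'rV[R[i]]_n => M ord0 j) vA; rewrite /= !mxE => <-.
    rewrite (le_trans (normc_sum _))//; apply: ler_sum => i _.
    by rewrite ComplexField.Normc.normcM mxE normc_real.
  have zh : 0 < \sum_j z j * h j ord0.
    rewrite lt_neqAle sumr_ge0 ?andbT => [|j _]; last by rewrite mulr_ge0// ltW.
    rewrite eq_sym psumr_neq0 => [|j _]; last by rewrite mulr_ge0// ltW.
    move/matrix0Pn : vN0 => [i [j vj]]; apply/hasP; exists j.
      by rewrite mem_index_enum.
    rewrite /= mulr_gt0// lt_neqAle z0 andbT eq_sym.
    by apply: contra vj => /eqP/ComplexField.Normc.eq0_normc vj0; rewrite (ord1 i) vj0.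
  rewrite -(ler_pM2r zh) !mulr_sumr.
  apply: (@le_trans _ _ (\sum_j (\sum_i z i * A i j) * h j ord0)).
    by apply: ler_sum => j _; rewrite mulrA ler_pM2r.
  under eq_bigr do rewrite mulr_suml.
  rewrite exchange_big /=; apply: ler_sum => i _.
  have := congr1 (fun M : 'cV[R]_n => M i ord0) Ah; rewrite /= !mxE => hE.
  rewrite mulrCA -hE mulr_sumr le_eqVlt; apply/orP; left; apply/eqP.
  by apply: eq_bigr => j _; rewrite mulrA.
by apply/eqP; rewrite eq_le ge_sup ?ub_le_sup//; exists lam.
Qed.
End Perron.

(** * Pairs of independent walkers *)

Lemma sum_sqr_gt0 (R : realDomainType) (T : finType) (w : T -> R) :
  \sum_u w u = 1 -> 0 < \sum_u w u ^+ 2.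
Proof.
move=> w1; rewrite lt_neqAle sumr_ge0 ?andbT => [|u _]; last exact: sqr_ge0.
rewrite eq_sym; apply: contra_eq_neq w1 => /eqP.
rewrite psumr_eq0 => [/allP w2|u _]; last exact: sqr_ge0.
rewrite big1 ?[_ == 1]eq_sym ?oner_eq0// => u _; apply/eqP.
by rewrite -sqrf_eq0; have := w2 u (mem_index_enum u).
Qed.

Section PairedWalk.
Context {R : realType} {T : finType}.
Variable P : T -> T -> R.
Hypothesis P_stochastic : stochastic P.

Let P0 u v : 0 <= P u v. Proof. by case: P_stochastic. Qed.
Let P1 u : \sum_v P u v = 1. Proof. by case: P_stochastic. Qed.

(** The Markov operator of the product chain, acting on functions of the pair. *)
Definition pair_step (f : T -> T -> R) u v :=
  \sum_a \sum_b P u a * P v b * f a b.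

Lemma eq_pair_step f g u v : f =2 g -> pair_step f u v = pair_step g u v.
Proof. by move=> fg; do 2 apply: eq_bigr => ? _; rewrite fg. Qed.

Lemma le_pair_step f g u v :
  (forall a b, f a b <= g a b) -> pair_step f u v <= pair_step g u v.
Proof.
by move=> fg; do 2 apply: ler_sum => ? _; rewrite ler_wpM2l// mulr_ge0.
Qed.

Lemma pair_step_cst c u v : pair_step (fun _ _ => c) u v = c.
Proof.
rewrite /pair_step; under eq_bigr => a _.
  under eq_bigr do rewrite mulrAC.
  rewrite -mulr_sumr P1 mulr1; over.
by rewrite -mulr_suml P1 mul1r.
Qed.

Lemma pair_stepB f g u v :
  pair_step (fun a b => f a b - g a b) u v = pair_step f u v - pair_step g u v.
Proof.
rewrite /pair_step -sumrB; apply: eq_bigr => a _.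
by rewrite -sumrB; apply: eq_bigr => b _; rewrite mulrBr.
Qed.

Lemma pair_stepZ c f u v :
  pair_step (fun a b => c * f a b) u v = c * pair_step f u v.
Proof.
rewrite /pair_step mulr_sumr; apply: eq_bigr => a _.
by rewrite mulr_sumr; apply: eq_bigr => b _; rewrite mulrCA.
Qed.

Lemma pair_step_ge0 f u v : (forall a b, 0 <= f a b) -> 0 <= pair_step f u v.
Proof. by move=> f0; rewrite -[leLHS](pair_step_cst 0 u v) le_pair_step. Qed.

(* The probability that walkers started at u and v are apart at each of the
   first t times, the initial time included. *)
Fixpoint no_meet t u v : R :=
  if t is t'.+1 then if u == v then 0 else pair_step (no_meet t') u v else 1.

(** The probability of coinciding after exactly [t] steps, that is at time [t + 1], whether or not
    there was an earlier meeting. *)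
Definition meet_at t : T -> T -> R :=
  iter t pair_step (fun u v => (u == v)%:R).

Lemma meet_at_ge0 t u v : 0 <= meet_at t u v.
Proof.
elim: t u v => [|t ih] u v; first by rewrite /meet_at/= ler0n.
exact: pair_step_ge0.
Qed.

Lemma no_meet_ge0 t u v : 0 <= no_meet t u v.
Proof.
elim: t u v => [|t ih] u v //=.
by case: ifP => // _; exact: pair_step_ge0.
Qed.

Lemma no_meet_le1 t u v : no_meet t u v <= 1.
Proof.
elim: t u v => [|t ih] u v //=; case: ifP => // _.
by rewrite -[leRHS](pair_step_cst 1 u v) le_pair_step.
Qed.

Lemma no_meet_meet_at t u v : no_meet t.+1 u v <= 1 - meet_at t u v.
Proof.
elim: t u v => [|t ih] u v.
  by rewrite /meet_at/=; case: eqP => _; rewrite ?subrr// pair_step_cst subr0.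
apply: (@le_trans _ _ (pair_step (no_meet t.+1) u v)).
  rewrite [leLHS]/=; case: ifP => // _.
  by apply: pair_step_ge0 => a b; exact: no_meet_ge0.
apply: (le_trans (le_pair_step _ _ ih)).
by rewrite pair_stepB pair_step_cst.
Qed.

Section Decay.
Variables (t : nat) (p : R).
Hypothesis meet_p : forall u v, p <= meet_at t u v.

(** From wherever the walkers are after the first [m] times, the next [t + 1] times include a
    meeting with probability at least [p]. *)
Lemma no_meet_decay m u v :
  no_meet (m + t.+1) u v <= (1 - p) * no_meet m u v.
Proof.
elim: m u v => [|m ih] u v.
  rewrite add0n mulr1 (le_trans (no_meet_meet_at _ _ _))//.
  by rewrite lerD2l lerN2.
rewrite addSn /=; case: ifP => _; first by rewrite mulr0.
by rewrite -pair_stepZ le_pair_step.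
Qed.

(** The first [t + 1] terms are at most 1 and decay controls the later ones, so the sum [s]
    satisfies [s <= t + 1 + (1 - p) * s]. The bound is uniform in [M] and so passes to the infinite
    series. *)
Lemma sum_no_meet_le M u v :
  0 < p -> \sum_(m < M) no_meet m u v <= t.+1%:R / p.
Proof.
move=> p0; rewrite ler_pdivlMr// mulrC.
have h1 : \sum_(m < M) no_meet m u v <= \sum_(m < t.+1 + M) no_meet m u v.
  rewrite addnC big_split_ord /= lerDl.
  by apply: sumr_ge0 => i _; exact: no_meet_ge0.
have h2 : \sum_(m < t.+1) no_meet m u v <= t.+1%:R.
  apply: (@le_trans _ _ (\sum_(m < t.+1) 1)).
    by apply: ler_sum => i _; exact: no_meet_le1.
  by rewrite sumr_const card_ord.
have h3 : \sum_(m < M) no_meet (t.+1 + m) u v <=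
    (1 - p) * \sum_(m < M) no_meet m u v.
  by rewrite mulr_sumr; apply: ler_sum => i _; rewrite addnC no_meet_decay.
move: h1; rewrite big_split_ord /= => h1.
have := le_trans h1 (lerD h2 h3).
by rewrite mulrBl mul1r; lra.
Qed.
End Decay.

(** * Two walkers in the stationary regime *)

Section Stationary.
Variable w : T -> R.
Hypothesis w0 : forall u, 0 <= w u.
Hypothesis w1 : \sum_u w u = 1.
Hypothesis w_stationary : forall v, \sum_u w u * P u v = w v.

Let S := \sum_u w u ^+ 2.

Let mean (f : T -> T -> R) := \sum_u \sum_v w u * w v * f u v.

Let le_mean f g : (forall a b, f a b <= g a b) -> mean f <= mean g.
Proof.
by move=> fg; do 2 apply: ler_sum => ? _; rewrite ler_wpM2l// mulr_ge0.
Qed.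

Let mean_step f : mean (pair_step f) = mean f.
Proof.
transitivity (\sum_u \sum_v \sum_a \sum_b (w u * P u a) * (w v * P v b) * f a b).
  apply: eq_bigr => u _; apply: eq_bigr => v _; rewrite mulr_sumr.
  apply: eq_bigr => a _; rewrite mulr_sumr; apply: eq_bigr => b _.
  by ring.
under eq_bigr do rewrite exchange_big/=.
rewrite exchange_big; apply: eq_bigr => a _ /=.
under eq_bigr do rewrite exchange_big/=.
rewrite exchange_big; apply: eq_bigr => b _ /=.
rewrite -[w a]w_stationary -[w b]w_stationary.
rewrite big_distrlr/= mulr_suml; apply: eq_bigr => u _.
by rewrite mulr_suml.
Qed.

Let mean_diag : mean (fun u v => (u == v)%:R) = S.
Proof.
apply: eq_bigr => u _; rewrite (bigD1 u)//= eqxx mulr1 big1 ?addr0 ?expr2//.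
by move=> v /negbTE vu; rewrite eq_sym vu mulr0.
Qed.

Let meanD f g : mean (fun u v => f u v + g u v) = mean f + mean g.
Proof.
rewrite /mean -big_split; apply: eq_bigr => u _ /=.
by rewrite -big_split; apply: eq_bigr => v _ /=; rewrite mulrDr.
Qed.

(** Union bound: by stationarity, a coincidence at any given time has probability [S]. *)
Lemma mean_no_meet t :
  1 - S *+ t <= \sum_u \sum_v w u * w v * no_meet t u v.
Proof.
have mean1 : mean (fun _ _ => 1) = 1.
  rewrite /mean; under eq_bigr => u _.
    under eq_bigr do rewrite mulr1.
    rewrite -mulr_sumr w1 mulr1; over.
  exact: w1.
elim: t => [|t ih]; first by rewrite subr0 -[X in X <= _]mean1.
(* Off the diagonal the two sides agree; on it the right side is 1. As a step preserves the mean,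
   each extra time costs at most [S]. *)
have : mean (pair_step (no_meet t)) <=
    mean (fun u v => (u == v)%:R + no_meet t.+1 u v).
  apply: le_mean => u v /=; case: eqP => _; last by rewrite add0r.
  rewrite addr0 -[leRHS](pair_step_cst 1 u v) le_pair_step// => a b.
  exact: no_meet_le1.
rewrite mean_step meanD mean_diag -/(mean _) => h.
by rewrite -/(mean _) in ih; rewrite mulrS; lra.
Qed.

Lemma mean_sum_no_meet t :
  (1 - S *+ t) *+ t.+1 <=
  \sum_u \sum_v w u * w v * \sum_(m < t.+1) no_meet m u v.
Proof.
have -> : \sum_u \sum_v w u * w v * \sum_(m < t.+1) no_meet m u v =
    \sum_(m < t.+1) \sum_u \sum_v w u * w v * no_meet m u v.
  rewrite [RHS]exchange_big; apply: eq_bigr => u _ /=.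
  rewrite [RHS]exchange_big; apply: eq_bigr => v _ /=.
  by rewrite mulr_sumr.
have -> : (1 - S *+ t) *+ t.+1 = \sum_(m < t.+1) (1 - S *+ t).
  by rewrite sumr_const card_ord.
apply: ler_sum => m _; apply: (le_trans _ (mean_no_meet m)).
rewrite lerD2l lerN2 ler_wpMn2l// ?sumr_ge0//; last by rewrite -ltnS.
by move=> u _; rewrite sqr_ge0.
Qed.

Lemma mean_sum_no_meet_ge : exists t,
  (4 * S)^-1 <= \sum_u \sum_v w u * w v * \sum_(m < t.+1) no_meet m u v.
Proof.
have S0 : 0 < S by exact: sum_sqr_gt0.
(* For this [t], [S * t] is at most 1/2 while [t + 1] is at least [1 / (2 * S)]; the product of the
   two lower bounds is [1 / (4 * S)]. *)
pose t := Num.trunc (2 * S)^-1; exists t.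
have S20 : 0 <= (2 * S)^-1 by rewrite invr_ge0 mulr_ge0// ltW.
apply: le_trans (mean_sum_no_meet t).
have /andP[t1 t2] := truncn_itv S20; rewrite -/t in t1 t2.
have -> : (4 * S)^-1 = 2^-1 * (2 * S)^-1 by rewrite !invfM; field; rewrite gt_eqF.
rewrite -[leRHS]mulr_natr ler_pM//; last exact: ltW.
rewrite -[S *+ t]mulr_natr.
have : S * t%:R <= S * (2 * S)^-1 by rewrite ler_pM2l.
have -> : S * (2 * S)^-1 = 2^-1 by field; rewrite gt_eqF.
lra.
Qed.
End Stationary.
End PairedWalk.

(** * Words and the block chain *)

Section Words.
Context {R : realType} {V : finType}.
Implicit Types (A P : V -> V -> R) (pi : V -> R).

Fixpoint path_weight A a (s : seq V) : R :=
  if s is b :: s' then A a b * path_weight A b s' else 1.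

Lemma path_weight_rcons A a s b :
  path_weight A a (rcons s b) = path_weight A a s * A (last a s) b.
Proof.
elim: s a => [|c s ih] a /=; first by rewrite mulrC.
by rewrite ih mulrA.
Qed.

Lemma path_weight_ge0 A a s : (forall u v, 0 <= A u v) -> 0 <= path_weight A a s.
Proof. by move=> A0; elim: s a => [|b s ih] a //=; rewrite mulr_ge0. Qed.

Lemma path_weightX A k a s :
  path_weight (fun u v => A u v ^+ k) a s = path_weight A a s ^+ k.
Proof.
elim: s a => [|b s ih] a /=; first by rewrite expr1n.
by rewrite ih exprMn.
Qed.

Lemma path_weightE A x0 n a s : size s = n ->
  path_weight A a s = \prod_(j < n) A (nth x0 (a :: s) j) (nth x0 s j).
Proof.
move=> <-; elim: s a => [|b s ih] a /=; first by rewrite big_ord0.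
by rewrite big_ord_recl /= (ih b).
Qed.

Lemma tnth_max_last n (u : n.+1.-tuple V) :
  tnth u ord_max = last (thead u) (behead u).
Proof.
case/tupleP: u => a s; rewrite (tnth_nth a) /= theadE (last_nth a) size_tuple.
by [].
Qed.

Lemma word_measureE P pi n (u : n.+1.-tuple V) :
  word_measure P pi u = pi (thead u) * path_weight P (thead u) (behead u).
Proof.
case/tupleP: u => a s; rewrite /word_measure theadE /=.
rewrite (path_weightE P a a (size_tuple s)); congr (_ * _).
by apply: eq_bigr => j _; rewrite !(tnth_nth a).
Qed.

Lemma big_tuple_cons n (F : V -> seq V -> R) :
  \sum_(u : n.+1.-tuple V) F (thead u) (behead u) =
  \sum_a \sum_(s : n.-tuple V) F a s.
Proof.
rewrite pair_big /=.
rewrite (reindex (fun p : V * n.-tuple V => [tuple of p.1 :: p.2])) /=.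
  by apply: eq_bigr => -[a s] _.
exists (fun u : n.+1.-tuple V => (thead u, [tuple of behead u])) => [[a s]|u] _ /=.
  by congr pair; apply: val_inj.
by rewrite -tuple_eta.
Qed.

(* The entry [a] of the vector [A^n 1]. *)
Fixpoint path_sum A n a : R :=
  if n is n'.+1 then \sum_b A a b * path_sum A n' b else 1.

Lemma path_sum_ge0 A n a : (forall u v, 0 <= A u v) -> 0 <= path_sum A n a.
Proof.
move=> A0; elim: n a => [|n ih] a //=.
by rewrite sumr_ge0// => b _; rewrite mulr_ge0.
Qed.

Lemma path_sum_stochastic P n a : stochastic P -> path_sum P n a = 1.
Proof.
move=> [_ P1]; elim: n a => [|n ih] a //=.
by under eq_bigr do rewrite ih mulr1.
Qed.

Lemma sum_path_weight A n a :
  \sum_(s : n.-tuple V) path_weight A a s = path_sum A n a.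
Proof.
elim: n a => [|n ih] a /=.
  by rewrite (bigD1 [tuple])//= big1 ?addr0// => s /negP[]; apply/eqP/tuple0.
transitivity (\sum_(u : n.+1.-tuple V)
    A a (thead u) * path_weight A (thead u) (behead u)).
  by apply: eq_bigr => u _; case/tupleP: u => b s; rewrite theadE.
rewrite (big_tuple_cons n (fun b s => A a b * path_weight A b s)).
by apply: eq_bigr => b _; rewrite -mulr_sumr ih.
Qed.
End Words.

(** * States and transitions of the block chain *)

Section Block.
Context {R : realType} {V : finType}.
Variables (P : V -> V -> R) (pi : V -> R).
Hypothesis P_stochastic : stochastic P.
Hypothesis pi_stationary : stationary P pi.
Variable n : nat.
Local Notation word := (n.+1.-tuple V).
Local Notation mu := (@word_measure R V P pi n).
Local Notation block := (block P pi n).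

Let P0 u v : 0 <= P u v. Proof. by case: P_stochastic. Qed.
Let P1 u : \sum_v P u v = 1. Proof. by case: P_stochastic. Qed.
Let pi0 v : 0 <= pi v. Proof. by case: pi_stationary. Qed.

Lemma word_measure_ge0 (u : word) : 0 <= mu u.
Proof. by rewrite word_measureE mulr_ge0// path_weight_ge0. Qed.

Lemma sum_block (F : word -> R) :
  \sum_(u : block) F (val u) = \sum_(u : word | 0 < mu u) F u.
Proof.
rewrite [RHS](reindex_omap (val : block -> word) insub); last first.
  by move=> u u0; rewrite insubT.
by apply: eq_bigl => u; rewrite valK eqxx (valP u).
Qed.

(** Trades the subtype of words of positive measure for all words, over which sums split letter by
    letter. *)
Lemma sum_block_all (F : word -> R) : (forall u, mu u = 0 -> F u = 0) ->
  \sum_(u : block) F (val u) = \sum_(u : word) F u.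
Proof.
move=> F0; rewrite sum_block [RHS](bigID (fun u => 0 < mu u)) /=.
rewrite [X in _ + X]big1 ?addr0// => u; rewrite -leNgt => u0.
by apply: F0; apply/eqP; rewrite eq_le u0 word_measure_ge0.
Qed.

Lemma sum_block_stationary : \sum_(u : block) block_stationary u = 1.
Proof.
rewrite (@sum_block_all mu)//.
under eq_bigr do rewrite word_measureE.
rewrite (big_tuple_cons n (fun a s => pi a * path_weight P a s)).
under eq_bigr do rewrite -mulr_sumr sum_path_weight path_sum_stochastic// mulr1.
by case: pi_stationary.
Qed.

(** Expresses the collision probability of stationary block walkers through powers of the squared
    kernel, whose growth is given by Perron theory. *)
Lemma sum_block_stationary_sqr :
  \sum_(u : block) block_stationary u ^+ 2 =
  \sum_a pi a ^+ 2 * path_sum (fun u v => P u v ^+ 2) n a.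
Proof.
rewrite (@sum_block_all (fun u => mu u ^+ 2)); last by move=> u ->; rewrite expr0n.
under eq_bigr do rewrite word_measureE exprMn -path_weightX.
rewrite (big_tuple_cons n
  (fun a s => pi a ^+ 2 * path_weight (fun u v => P u v ^+ 2) a s)).
by under eq_bigr do rewrite -mulr_sumr sum_path_weight.
Qed.

Definition shift_word (u : word) b : word := [tuple of rcons (behead u) b].

Lemma shift_word_last u b : tnth (shift_word u b) ord_max = b.
Proof.
rewrite tnth_max_last /thead (tnth_nth b) /=.
by case: (behead u) => //= c s; rewrite last_rcons.
Qed.

Lemma overlap_shift (u v : word) :
  [forall j : 'I_n, tnth u (upper j) == tnth v (lower j)] =
  (v == shift_word u (tnth v ord_max)).
Proof.
apply/forallP/eqP => [uv|-> j].
  have x0 := thead u; apply: val_inj; apply: (@eq_from_nth _ x0).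
    by rewrite !size_tuple.
  move=> i; rewrite size_tuple => iN.
  rewrite /= nth_rcons size_behead size_tuple /=.
  case: ltngtP => [ilt|igt|->].
  - have /eqP := uv (Ordinal ilt).
    by rewrite !(tnth_nth x0)/= nth_behead => ->.
  - by move: iN; rewrite ltnS leqNgt igt.
  - by rewrite (tnth_nth x0).
rewrite (tnth_nth (thead u)) (tnth_nth (thead u)) /=.
by rewrite nth_rcons size_behead size_tuple /= ltn_ord nth_behead.
Qed.

(* Removing the last letter of [a :: v] and prefixing a letter to [v] give two
   ways to split off a transition from the same word of length n + 2. *)
Lemma word_measure_stationary (v : word) :
  \sum_(u : word) mu u *
     (if v == shift_word u (tnth v ord_max)
      then P (tnth u ord_max) (tnth v ord_max) else 0) = mu v.
Proof.
(* The overlap condition says that the tail [r] of [u] is [v] without its last letter. *)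
pose F a (r : seq V) := pi a * path_weight P a r *
  (if r == belast (thead v) (behead v)
   then P (last a r) (tnth v ord_max) else 0).
transitivity (\sum_(u : word) F (thead u) (behead u)).
  apply: eq_bigr => u _; rewrite word_measureE (tnth_max_last u) /F.
  suff -> : (v == shift_word u (tnth v ord_max)) =
      (behead u == belast (thead v) (behead v) :> seq V) by [].
  rewrite -val_eqE /= [X in X == _](_ : _ = thead v :: behead v); last first.
    by rewrite {1}[v]tuple_eta.
  by rewrite lastI tnth_max_last eqseq_rcons eqxx andbT eq_sym.
rewrite (big_tuple_cons n F).
case/tupleP: v @F => b s F; rewrite word_measureE theadE /=.
(* Stationarity of [pi] expands [pi b] over the letter [a] put in front of [v]. *)
have [_ _ <-] := pi_stationary; rewrite mulr_suml.
apply: eq_bigr => a _.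
rewrite (bigD1 [tuple of belast b s])//= [X in _ + X]big1 ?addr0.
  rewrite /F eqxx -!mulrA -path_weight_rcons tnth_max_last theadE /=.
  by rewrite -lastI.
by move=> r /negbTE rs; rewrite /F ifF ?mulr0//; apply: contraFF rs.
Qed.

Lemma block_transE (u v : block) : block_trans u v =
  if val v == shift_word (val u) (tnth (val v) ord_max)
  then P (tnth (val u) ord_max) (tnth (val v) ord_max) else 0.
Proof. by rewrite /block_trans overlap_shift. Qed.

Lemma block_stationaryP (v : block) :
  \sum_u block_stationary u * block_trans u v = block_stationary v.
Proof.
rewrite -[RHS]word_measure_stationary.
rewrite -sum_block_all => [|u ->]; last by rewrite mul0r.
by apply: eq_bigr => u _; rewrite block_transE.
Qed.

(** The sum over states becomes a sum over appended letters; letters leading to a word of measure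
    zero contribute nothing. *)
Lemma block_step (u : block) (F : word -> R) :
  \sum_(v : block) block_trans u v * F (val v) =
  \sum_b P (tnth (val u) ord_max) b * F (shift_word (val u) b).
Proof.
under eq_bigr do rewrite block_transE.
rewrite (@sum_block_all (fun v => (if v == shift_word (val u) (tnth v ord_max)
  then P (tnth (val u) ord_max) (tnth v ord_max) else 0) * F v)); last first.
  move=> v v0; case: ifP => vu; last by rewrite mul0r.
  (* Stationarity writes [mu v = 0] as a sum of nonnegative terms. The term of [u] vanishes and
     [mu u > 0], so the transition weight is zero. *)
  have := word_measure_stationary v; rewrite v0 => /eqP.
  rewrite psumr_eq0 => [/allP /(_ (val u) (mem_index_enum _))|w _]; last first.
    by rewrite mulr_ge0 ?word_measure_ge0//; case: ifP.
  by rewrite /= vu mulf_eq0 gt_eqF ?(valP u)//= => /eqP ->; rewrite mul0r.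
rewrite (bigID (fun v => v == shift_word (val u) (tnth v ord_max))) /=.
rewrite [X in _ + X]big1 ?addr0 => [|v /negbTE ->]; last by rewrite mul0r.
rewrite (reindex_onto (shift_word (val u)) (fun v => tnth v ord_max)) /=.
  apply: eq_big => [b|b]; first by rewrite shift_word_last !eqxx.
  by rewrite shift_word_last eqxx.
by move=> v /eqP {2}->.
Qed.

Lemma block_trans_stochastic : stochastic (@block_trans R V P pi n).
Proof.
split=> [u v|u]; first by rewrite block_transE; case: ifP.
have := block_step u (fun _ => 1).
under eq_bigr do rewrite mulr1.
by under [RHS]eq_bigr do rewrite mulr1; rewrite P1.
Qed.

Local Notation block_pair_step := (pair_step (@block_trans R V P pi n)).

Lemma block_pair_step_word (F : word -> word -> R) (u v : block) :
  block_pair_step (fun a b => F (val a) (val b)) u v =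
  pair_step P (fun a b => F (shift_word (val u) a) (shift_word (val v) b))
    (tnth (val u) ord_max) (tnth (val v) ord_max).
Proof.
rewrite /pair_step.
under eq_bigr => a _.
  under eq_bigr do rewrite -mulrA.
  rewrite -mulr_sumr (block_step v (F (val a))); over.
rewrite (block_step u (fun a => \sum_b P (tnth (val v) ord_max) b *
  F a (shift_word (val v) b))).
apply: eq_bigr => a _; rewrite mulr_sumr.
by apply: eq_bigr => b _; rewrite mulrA.
Qed.

Local Notation Q := (fun u v => P u v ^+ 2).

Let Q0 u v : 0 <= Q u v. Proof. exact: sqr_ge0. Qed.

(** When the words agree from position [i] on, it is enough that both walkers append the same [i]
    letters, which pushes out the part where they may differ. A common letter costs the square of
    its transition probability. *)
Lemma meet_at_agree i (u v : block) : (i <= n)%N ->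
  drop i (val u) = drop i (val v) ->
  path_sum Q i (tnth (val u) ord_max) <=
    meet_at (@block_trans R V P pi n) i u v.
Proof.
elim: i u v => [|i ih] u v.
  by rewrite !drop0 => _ uv; rewrite /meet_at /= (val_inj (val_inj uv)) eqxx.
move=> i_n uv.
have uvmax : tnth (val u) ord_max = tnth (val v) ord_max.
  have := congr1 (fun s => nth (thead (val u)) s (n - i.+1)) uv.
  by rewrite !nth_drop subnKC// !(tnth_nth (thead (val u))).
pose F (x y : word) : R :=
  if drop i x == drop i y then path_sum Q i (tnth x ord_max) else 0.
apply: (@le_trans _ _ (block_pair_step (fun a b => F (val a) (val b)) u v)).
  rewrite block_pair_step_word -uvmax /pair_step /=.
  apply: ler_sum => a _; rewrite (bigD1 a)//= /F shift_word_last.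
  rewrite ifT; last first.
    rewrite /= -!drop1 !drop_rcons ?size_drop ?size_tuple ?subSS ?subn0 1?ltnW//.
    by rewrite !drop_drop !addn1 uv.
  rewrite expr2 lerDl sumr_ge0// => b _; rewrite !mulr_ge0//.
  by case: ifP => // _; rewrite path_sum_ge0.
apply: (le_pair_step block_trans_stochastic) => a b; rewrite /F.
case: eqP => [ab|_]; first by apply: ih => //; exact: ltnW.
exact: (meet_at_ge0 block_trans_stochastic).
Qed.

(** The last letters of the block walkers perform the walk [P]. After [k] steps that make them
    equal, [n] more common letters make the words equal. *)
Lemma meet_at_last k (u v : block) :
  iter k (pair_step P) (fun a b => if a == b then path_sum Q n a else 0)
    (tnth (val u) ord_max) (tnth (val v) ord_max) <=
  meet_at (@block_trans R V P pi n) (k + n) u v.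
Proof.
elim: k u v => [|k ih] u v.
  rewrite add0n /=; case: eqP => [uv|_]; last exact: (meet_at_ge0 block_trans_stochastic).
  apply: meet_at_agree => //.
  have dropn (w : word) : drop n w = [:: tnth w ord_max].
    rewrite (drop_nth (thead w)) ?size_tuple// drop_oversize ?size_tuple//.
    by rewrite (tnth_nth (thead w)).
  by rewrite !dropn uv.
rewrite addSn [X in _ <= X]/=.
apply: le_trans (le_pair_step block_trans_stochastic _ _ ih).
rewrite (block_pair_step_word (fun a b => iter k (pair_step P)
  (fun a b => if a == b then path_sum Q n a else 0)
    (tnth a ord_max) (tnth b ord_max))).
rewrite le_eqVlt; apply/orP; left; apply/eqP; apply: eq_pair_step => a b.
by rewrite !shift_word_last.
Qed.
End Block.

(** * Expected meeting times *)

Lemma probability_finType_partition {d} {Omega : measurableType d} {R : realType}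
    (mu : probability Omega R) (I : finType) (Z : Omega -> I)
    (A : set Omega) :
  measurable A -> (forall z, measurable [set w | Z w = z]) ->
  mu A = (\sum_z mu (A `&` [set w | Z w = z]))%E.
Proof.
move=> mA mZ.
rewrite (fsbig_seq _ _ (index_enum_uniq I)).
have -> : [set` index_enum I] = [set: I].
  by apply/seteqP; split=> z //= _; rewrite mem_index_enum.
rewrite -(measure_fin_bigcup mu finite_finset).
- congr (mu _); apply/seteqP; split=> [w Aw|w [z _ []//]].
  by exists (Z w).
- apply/trivIsetP => i j _ _ /eqP ij; apply/seteqP.
  by split=> // w [[_ /= wi] [_ /= wj]]; apply: ij; rewrite -wi.
- by move=> z _; exact: measurableI.
Qed.

(** * Laws of the meeting events of two walkers *)

Section Walkers.
Context {R : realType} {d : measure_display} {Omega : measurableType d}.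
Variable Pr : probability Omega R.
Context {T : finType}.
Variables (P : T -> T -> R) (u v : T) (X Y : nat -> Omega -> T).
Hypothesis P_stochastic : stochastic P.
Hypothesis XY_walkers : independent_walkers Pr P u v X Y.

Let mX k z : measurable [set w | X k w = z].
Proof. by case: XY_walkers => [[]]. Qed.

Let mY k z : measurable [set w | Y k w = z].
Proof. by case: XY_walkers => [_ []]. Qed.

Let XY_pair k w := (X k w, Y k w).

Let mXY k z : measurable [set w | XY_pair k w = z].
Proof.
rewrite (_ : mkset _ = [set w | X k w = z.1] `&` [set w | Y k w = z.2]).
  exact: measurableI.
by case: z => a b; apply/seteqP; split=> [w [<- <-]|w [/= <- <-]].
Qed.

Lemma measurable_cylinder (Z : nat -> Omega -> T) k x :
  (forall k z, measurable [set w | Z k w = z]) -> measurable (cylinder Z k x).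
Proof.
move=> mZ; rewrite (_ : cylinder _ _ _ =
    \bigcap_(i in [set i | (i < k)%N]) [set w | Z i w = x i]) //.
by apply: bigcap_measurableType => i _.
Qed.

(** The window starts at a free index [j], so that induction on its length can advance the
    conditioning cylinders. *)
Definition apart j t := [set w | forall i, (i < t)%N -> X (j + i) w <> Y (j + i) w].

Lemma measurable_apart j t : measurable (apart j t).
Proof.
rewrite (_ : apart _ _ = \bigcap_(i in [set i | (i < t)%N])
    ~` \bigcup_(z in [set: T]) [set w | XY_pair (j + i) w = (z, z)]).
  apply: bigcap_measurableType => i _; apply: measurableC.
  by apply: fin_bigcup_measurable => // z _; exact: mXY.
apply/seteqP; split=> w h i it; last first.
  by move=> e; apply: (h i it); exists (X (j + i) w) => //=; rewrite /XY_pair e.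
by move=> [z _ /= [e1 e2]]; apply: (h i it); rewrite e1 e2.
Qed.

Let upd (x : nat -> T) k a i := if i == k then a else x i.

Let upd_eq x k a : upd x k a k = a. Proof. by rewrite /upd eqxx. Qed.

Let upd_neq x k a i : (i < k)%N -> upd x k a i = x i.
Proof. by move=> ik; rewrite /upd ltn_eqF. Qed.

Let cylinder_upd (Z : nat -> Omega -> T) k x a :
  cylinder Z k.+1 (upd x k a) = cylinder Z k x `&` [set w | Z k w = a].
Proof.
apply/seteqP; split=> [w h|w [h1 h2] i].
  split; last by have := h k (ltnSn k); rewrite /upd eqxx.
  by move=> i ik; have := h i (ltnW ik); rewrite /upd ltn_eqF.
rewrite ltnS leq_eqVlt /upd; case: eqP => [-> _ //|_ /= ik].
exact: h1.
Qed.

Let cylinder_eq (Z : nat -> Omega -> T) k x y :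
  (forall i, (i < k)%N -> x i = y i) -> cylinder Z k x = cylinder Z k y.
Proof.
by move=> xy; apply/seteqP; split=> w h i ik; rewrite h// xy.
Qed.

(** Induction on [t], splitting by the pair of states at index [j + 1]: this lengthens both
    cylinders by one and reproduces the recursion of [no_meet]. The window shares index [j] with the
    cylinders. *)
Lemma prob_apart_cylinder t j x y :
  Pr (cylinder X j.+1 x `&` cylinder Y j.+1 y `&` apart j t) =
  (Pr (cylinder X j.+1 x) * Pr (cylinder Y j.+1 y) *
   (no_meet P t (x j) (y j))%:E)%E.
Proof.
have [wX wY indep] := XY_walkers.
elim: t j x y => [|t ih] j x y.
  have -> : apart j 0 = setT by apply/seteqP.
  by rewrite setIT indep mule1.
rewrite [no_meet _ _ _ _]/=; case: eqP => [xy|xy].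
  rewrite mule0 (_ : _ `&` _ = set0) ?measure0//.
  apply/seteqP; split=> // w [[hx hy] /(_ 0%N (ltn0Sn _))].
  by rewrite addn0 hx// hy.
(* The cylinders already separate the walkers at index [j], so the window may start at [j + 1]. *)
have -> : cylinder X j.+1 x `&` cylinder Y j.+1 y `&` apart j t.+1 =
    cylinder X j.+1 x `&` cylinder Y j.+1 y `&` apart j.+1 t.
  apply/seteqP; split=> w [[hx hy] h]; split=> // i it.
    by rewrite addSnnS; exact: h.
  case: i it => [|i] it; first by rewrite addn0 hx// hy.
  by rewrite -addSnnS; exact: h.
rewrite (probability_finType_partition Pr _ (mXY j.+1)); last first.
  apply: measurableI; last exact: measurable_apart.
  by apply: measurableI; exact: measurable_cylinder.
transitivity (\sum_(z : T * T) Pr (cylinder X j.+1 x) * Pr (cylinder Y j.+1 y) *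
    (P (x j) z.1 * P (y j) z.2 * no_meet P t z.1 z.2)%:E)%E.
  apply: eq_bigr => -[a b] _.
  rewrite (_ : _ `&` [set w | _] = cylinder X j.+2 (upd x j.+1 a) `&`
      cylinder Y j.+2 (upd y j.+1 b) `&` apart j.+1 t); last first.
    rewrite !cylinder_upd; apply/seteqP; split.
      by move=> w [[[? ?] ?] [/= ? ?]].
    by move=> w [[[? /= Xa] [? /= Yb]] ?]; split=> //=; rewrite /XY_pair Xa Yb.
  rewrite ih (walk_step wX) (walk_step wY) !upd_eq !upd_neq//.
  rewrite (@cylinder_eq X j.+1 _ x); last by move=> i ij; rewrite upd_neq.
  rewrite (@cylinder_eq Y j.+1 _ y); last by move=> i ij; rewrite upd_neq.
  by rewrite !EFinM muleACA !muleA.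
have h (A : set Omega) : measurable A -> Pr A = (fine (Pr A))%:E.
  by move=> mA; rewrite fineK// fin_num_measure.
rewrite (h (cylinder X _ _)); last exact: measurable_cylinder.
rewrite (h (cylinder Y _ _)); last exact: measurable_cylinder.
rewrite -!EFinM; under eq_bigr do rewrite -EFinM.
rewrite sumEFin -mulr_sumr; congr (_ * _)%:E.
by rewrite /pair_step pair_big.
Qed.

(** The cylinders fixing the starting states have probability 1, so intersecting with them does not
    change the probability. *)
Lemma prob_apart t : Pr (apart 0 t) = (no_meet P t u v)%:E.
Proof.
have [wX wY indep] := XY_walkers.
have cyl1 (Z : nat -> Omega -> T) z : cylinder Z 1 (fun=> z) = [set w | Z 0%N w = z].
  by apply/seteqP; split=> [w h|w h [|i]//]; exact: h.
have X1 : Pr (cylinder X 1 (fun=> u)) = 1%E by rewrite cyl1; case: wX.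
have Y1 : Pr (cylinder Y 1 (fun=> v)) = 1%E by rewrite cyl1; case: wY.
have := prob_apart_cylinder t 0 (fun=> u) (fun=> v).
rewrite X1 Y1 !mul1e => <-.
set B := cylinder X _ _ `&` _.
have mB : measurable B by apply: measurableI; exact: measurable_cylinder.
have B0 : Pr (~` B) = 0%E.
  by rewrite probability_setC// indep X1 Y1 mule1 subee.
have mA := measurable_apart 0 t.
rewrite setIC (measureDI Pr mA mB) [X in (X + _)%E](_ : _ = 0%E) ?add0e//.
apply: (subset_measure0 (B := ~` B)) => //.
- exact: measurableD.
- exact: measurableC.
Qed.

(** Pointwise tail sum: the meeting time counts the [t] for which the walkers are apart at the first
    [t] times. The term [t = 0] always counts, which matches an initial time of 1. *)
Lemma meeting_timeE w :
  meeting_time X Y w = (\sum_(0 <= t <oo) (\1_(apart 0 t) w)%:E)%E :> \bar R.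
Proof.
have ind0 t : (0 <= (\1_(apart 0 t) w)%:E :> \bar R)%E by rewrite lee_fin.
apply/eqP; rewrite eq_le; apply/andP; split.
  have sum_apart M : (forall i, (i < M)%N -> X i w <> Y i w) ->
      (M.+1%:R%:E <= \sum_(0 <= t <oo) (\1_(apart 0 t) w)%:E :> \bar R)%E.
    move=> hM; apply: le_trans (nneseries_lim_ge M.+1 _) => //.
    rewrite big_mkord sumEFin lee_fin (eq_bigr (fun=> 1)).
      by rewrite sumr_const card_ord.
    move=> i _; rewrite indicE mem_set// => k ki; apply: hM.
    by rewrite add0n (leq_trans ki)// -ltnS.
  (* Either there is a first meeting index [k], or [sum_apart] holds for every [M] and the series
     diverges. *)
  have [[k0 k0P]|noM] := pselect (exists k, X k w == Y k w).
    have [k /eqP kP kmin] := ex_minnP (ex_intro (fun k => X k w == Y k w) k0 k0P).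
    apply: (@le_trans _ _ k.+1%:R%:E).
      by apply: ereal_inf_lbound; exists k.
    apply: sum_apart => i ik /eqP/kmin.
    by rewrite leqNgt ik.
  suff -> : (\sum_(0 <= t <oo) (\1_(apart 0 t) w)%:E)%E = +oo%E :> \bar R.
    by rewrite leey.
  apply/eqyP => A A0; apply: (@le_trans _ _ (Num.trunc A).+1%:R%:E).
    by rewrite lee_fin ltW// truncnS_gt.
  by apply: sum_apart => i _ e; apply: noM; exists i; rewrite e.
(* A meeting at index [k] leaves only the terms [t <= k], which are [k + 1] in number. *)
apply: le_ereal_inf_tmp => _ [k /= kP <-].
apply: lime_le; first by apply: is_cvg_nneseries.
apply: nearW => M; rewrite big_mkord sumEFin lee_fin.
apply: (@le_trans _ _ (\sum_(i < M) (i < k.+1)%:R)).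
  apply: ler_sum => i _; rewrite indicE ler_nat.
  have [_|ki] := ltnP i k.+1; first exact: leq_b1.
  by rewrite memNset//= => /(_ k ki).
rewrite -natr_sum ler_nat (_ : (\sum_(i < M) (i < k.+1))%N = minn M k.+1).
  exact: geq_minr.
elim: M => [|M ih]; first by rewrite big_ord0 min0n.
by rewrite big_ord_recr /= ih /minn; case: ltngtP => // ?; case: ltngtP => //; lia.
Qed.

Lemma expected_meeting_timeE :
  expected_meeting_time Pr X Y = (\sum_(0 <= t <oo) (no_meet P t u v)%:E)%E.
Proof.
rewrite /expected_meeting_time.
under eq_integral do rewrite meeting_timeE.
rewrite integral_nneseries//.
- apply: eq_eseriesr => t _.
  rewrite integral_indic//; last exact: measurable_apart.
  by rewrite setIT; exact: prob_apart.
- move=> t; apply/measurable_realfun.measurable_EFinP.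
  apply: measurable_realfun.measurable_indic.
  exact: measurable_apart.
Qed.

Lemma expected_meeting_time_ge M :
  ((\sum_(t < M) no_meet P t u v)%:E <= expected_meeting_time Pr X Y)%E.
Proof.
rewrite expected_meeting_timeE -sumEFin.
rewrite -(big_mkord xpredT (fun t => (no_meet P t u v)%:E)).
by apply: nneseries_lim_ge => t _ _; rewrite lee_fin no_meet_ge0.
Qed.

Lemma expected_meeting_time_le B :
  (forall M, \sum_(t < M) no_meet P t u v <= B) ->
  (expected_meeting_time Pr X Y <= B%:E)%E.
Proof.
move=> hB; rewrite expected_meeting_timeE; apply: lime_le.
  by apply: is_cvg_nneseries => t _ _; rewrite lee_fin no_meet_ge0.
by apply: nearW => M; rewrite big_mkord sumEFin lee_fin.
Qed.
End Walkers.

(** * Exponential growth *)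

Lemma sum_enum_val (R : nmodType) (V : finType) (F : V -> R) :
  \sum_a F a = \sum_(i < #|V|) F (enum_val i).
Proof.
rewrite (reindex (fun i : 'I_#|V| => enum_val i))//.
exact/onW_bij/enum_val_bij.
Qed.

Section Growth.
Context {R : realType} {V : finType}.
Variable P : V -> V -> R.
Hypothesis P_stochastic : stochastic P.
Hypothesis P_mixing : mixing P.
Local Notation Q := (fun u v => P u v ^+ 2).

Let P0 u v : 0 <= P u v. Proof. by case: P_stochastic. Qed.

(** With [f] viewed as a matrix and [K] the kernel, one pair step is [K f K^T]. Iterating exposes a
    power of [K], which mixing makes positive. *)
Lemma kernel_mx_iter_pair_step k (f : V -> V -> R) :
  kernel_mx (iter k (pair_step P) f) =
  kernel_mx P ^+ k *m kernel_mx f *m (kernel_mx P ^+ k)^T.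
Proof.
elim: k => [|k ih]; first by rewrite expr0 trmx1 mul1mx mulmx1.
have step g : kernel_mx (pair_step P g) =
    kernel_mx P *m kernel_mx g *m (kernel_mx P)^T.
  apply/matrixP => i j; rewrite !mxE /pair_step exchange_big sum_enum_val.
  apply: eq_bigr => b _; rewrite !mxE mulr_suml sum_enum_val.
  by apply: eq_bigr => a _; rewrite !mxE mulrAC.
by rewrite iterS step ih exprS trmx_mul !mulmxA.
Qed.

Lemma mixing_pair_step : exists k, exists2 delta : R, 0 < delta &
  forall f a b, (forall x y, 0 <= f x y) ->
    delta * \sum_c f c c <= iter k (pair_step P) f a b.
Proof.
have [k _ Pk] := P_mixing; exists k.
have [C C0 Ck] := @finite_domination R ('I_#|V| * 'I_#|V|)%type (fun=> 1)
  (fun p => (kernel_mx P ^+ k) p.1 p.2) (fun p => Pk p.1 p.2).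
(* [C^-1] bounds the entries of the [k]-th power from below, and each walker contributes one such
   factor. *)
exists (C^-1 ^+ 2); first by rewrite exprn_gt0// invr_gt0.
have C1 i j : C^-1 <= (kernel_mx P ^+ k) i j.
  by rewrite -[leLHS]mulr1 ler_pdivrMl//; exact: (Ck (i, j)).
move=> f a b f0.
have -> : iter k (pair_step P) f a b =
    kernel_mx (iter k (pair_step P) f) (enum_rank a) (enum_rank b).
  by rewrite mxE !enum_rankK.
rewrite kernel_mx_iter_pair_step mxE sum_enum_val mulr_sumr.
apply: ler_sum => j _; rewrite [in leRHS]mxE.
rewrite (bigD1 j)//= !mxE mulrDl -[leLHS]addr0.
have C10 : 0 <= C^-1 by rewrite invr_ge0 ltW.
have K0 i l : 0 <= (kernel_mx P ^+ k) i l by exact: le_trans (C1 i l).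
apply: lerD; last first.
  rewrite mulr_ge0// sumr_ge0// => i _.
  by rewrite mulr_ge0// mxE.
by rewrite expr2 mulrAC ler_pM// ?mulr_ge0// ler_wpM2r.
Qed.

(** Squaring entries keeps the zero pattern, so [Q] inherits a positive power from [P] and has
    Perron vectors. *)
Lemma perron_kernel (v0 : V) : exists lam : R, exists2 x : V -> R,
  0 < lam /\ Lrate P = - ln lam &
  (forall a, 0 < x a) /\ forall b, \sum_a x a * Q a b = lam * x b.
Proof.
have [k k0 Pk] := P_mixing.
have Q0 i j : 0 <= kernel_mx Q i j by rewrite mxE sqr_ge0.
have Qk i j : 0 < (kernel_mx Q ^+ k) i j.
  apply: (@mx_expn_gt0 R _ (kernel_mx P)) => // a b; rewrite !mxE//.
  by move=> ?; rewrite exprn_gt0.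
have V0 : (0 < #|V|)%N by apply/card_gt0P; exists v0.
have [lam [x [h [lam0 x0 h0 xQ Qh]]]] := perron V0 k0 Q0 Qk.
exists lam, (fun a => x ord0 (enum_rank a)).
  split=> //; rewrite /Lrate (spectral_radius_eq (lam := lam) (x := x) (h := h))//.
    exact: ltW.
  by apply/matrix0Pn; exists ord0, (Ordinal V0); rewrite gt_eqF.
split=> // b; rewrite sum_enum_val.
have := congr1 (fun M : 'rV[R]_#|V| => M ord0 (enum_rank b)) xQ.
rewrite /= !mxE => <-; apply: eq_bigr => i _.
by rewrite enum_valK mxE enum_rankK.
Qed.

(** Pairing with the left eigenvector [x] gives exactly [lam ^+ n] times a constant. On a finite set
    [x] is comparable with the constant 1 in both directions, whence [c] and [C]. *)
Lemma path_sum_growth (v0 : V) : exists2 lam : R, 0 < lam /\ Lrate P = - ln lam &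
  exists c C : R, [/\ 0 < c, 0 < C & forall n,
    c * lam ^+ n <= \sum_a path_sum Q n a <= C * lam ^+ n].
Proof.
have [lam [x lam0 [x0 xQ]]] := perron_kernel v0.
exists lam => //.
have xsum n : \sum_a x a * path_sum Q n a = lam ^+ n * \sum_a x a.
  elim: n => [|n ih]; first by rewrite expr0 mul1r; under eq_bigr do rewrite mulr1.
  rewrite exprS -mulrA -ih /=.
  under eq_bigr do rewrite mulr_sumr.
  rewrite exchange_big mulr_sumr; apply: eq_bigr => b _ /=.
  by rewrite mulrA -xQ mulr_suml; apply: eq_bigr => a _; rewrite mulrA.
have s0 : 0 < \sum_a x a.
  by rewrite (bigD1 v0)//= ltr_pwDl// sumr_ge0// => a _; exact: ltW.
have q0 n a : 0 <= path_sum Q n a by apply: path_sum_ge0 => *; exact: sqr_ge0.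
have [C C0 hC] := @finite_domination R V (fun=> 1) x x0.
have [D D0 hD] := @finite_domination R V x (fun=> 1) (fun=> ltr01).
exists (D^-1 * \sum_a x a), (C * \sum_a x a); split.
- by rewrite mulr_gt0// invr_gt0.
- by rewrite mulr_gt0.
move=> n; rewrite -!mulrA ![(\sum_a x a) * _]mulrC -xsum; apply/andP; split.
  rewrite ler_pdivrMl// mulr_sumr; apply: ler_sum => a _.
  by rewrite ler_wpM2r//; have := hD a; rewrite mulr1.
rewrite mulr_sumr; apply: ler_sum => a _.
by rewrite mulrA -[leLHS]mul1r ler_wpM2r.
Qed.
End Growth.

(** Crude, but enough for [ln n / n] to tend to 0; it is [ln y <= y] at the square root of [x]. *)
Lemma ln_le_sqrt (R : realType) (x : R) : 0 < x -> ln x <= 2 * Num.sqrt x.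
Proof.
move=> x0; have s0 : 0 < Num.sqrt x by rewrite sqrtr_gt0.
rewrite -{1}(sqr_sqrtr (ltW x0)) lnXn// mulr_natl lerMn2r/=.
by rewrite ltW// ln_sublinear.
Qed.

(** The factor [n + 1] in the upper bound costs only [ln (n + 1) / (n + 1)], so both bounds squeeze
    to the same limit. *)
Lemma growth_rate (R : realType) (f : nat -> \bar R) (lam c C : R) :
  0 < lam -> 0 < c -> 0 < C ->
  (forall n, (c / lam ^+ n)%:E <= f n <= (C * n.+1%:R / lam ^+ n)%:E)%E ->
  ((n.+1%:R^-1)%:E * lne (f n))%E @[n --> \oo] --> (- ln lam)%:E.
Proof.
move=> lam0 c0 C0 fP.
(* Division is by [n + 1] while the exponent is [n]; the mismatch leaves [ln lam / (n + 1)], which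
   tends to 0. *)
have lnlam n x : 0 < x -> n.+1%:R^-1 * ln (x / lam ^+ n) =
    n.+1%:R^-1 * ln x - ln lam + n.+1%:R^-1 * ln lam :> R.
  move=> x0; rewrite ln_div ?posrE ?exprn_gt0// lnXn// -[ln lam *+ n]mulr_natl.
  have n0 : n.+1%:R != 0 :> R by rewrite pnatr_eq0.
  rewrite (_ : n%:R = n.+1%:R - 1); last by rewrite -addn1 natrD addrK.
  by field.
have cst (a : R) : n.+1%:R^-1 * a @[n --> \oo] --> (0 : R).
  rewrite -[X in _ --> X](mul0r a); apply: cvgM; last exact: cvg_cst.
  exact: cvg_harmonic.
pose lo n : R := n.+1%:R^-1 * ln (c / lam ^+ n).
pose up n : R := n.+1%:R^-1 * ln C - ln lam + n.+1%:R^-1 * ln lam +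
  2 * Num.sqrt n.+1%:R^-1.
apply: (@squeeze_cvge _ _ _ _ (EFin \o lo) _ (EFin \o up)).
- apply: nearW => n; have := fP n; case: (f n) => [r| |]; last 2 first.
  + by rewrite leye_eq => /andP[_ /eqP].
  + by rewrite leeNy_eq => /andP[/eqP].
  rewrite !lee_fin => /andP[f1 f2].
  have n0 : 0 < n.+1%:R :> R by rewrite ltr0n.
  have r0 : 0 < r by apply: lt_le_trans f1; rewrite divr_gt0// exprn_gt0.
  rewrite lne_EFin// -EFinM !lee_fin /lo; apply/andP; split.
    rewrite ler_pM2l ?invr_gt0// ler_ln// posrE divr_gt0//.
    by rewrite exprn_gt0.
  apply: (@le_trans _ _ (n.+1%:R^-1 * ln (C * n.+1%:R / lam ^+ n))).
    rewrite ler_pM2l ?invr_gt0// ler_ln// posrE divr_gt0// ?exprn_gt0//.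
    exact: mulr_gt0.
  rewrite lnlam ?mulr_gt0// /up lnM ?posrE// mulrDr.
  rewrite -!addrA lerD2l addrC -!addrA; do 2 rewrite lerD2l.
  rewrite ler_pdivrMl// mulrCA; apply: (le_trans (ln_le_sqrt n0)).
  by rewrite ler_pM2l// (sqrtrV (ltW n0)) -[X in X / _](sqr_sqrtr (ltW n0)) expr2 mulfK//.
- apply: cvg_EFin; first exact: nearW.
  rewrite -[X in _ --> X]add0r -[X in _ --> X]addr0.
  under eq_cvg do rewrite /= /lo lnlam//.
  by apply: cvgD => //; apply: cvgD => //; exact: cvg_cst.
- apply: cvg_EFin; first exact: nearW.
  rewrite -[X in _ --> X]add0r -[X in _ --> X]addr0 -[X in _ --> X]addr0.
  apply: cvgD.
    by apply: cvgD => //; apply: cvgD => //; exact: cvg_cst.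
  rewrite -(mulr0 2) -sqrtr0; apply: cvgM; first exact: cvg_cst.
  apply: (cvg_comp harmonic Num.sqrt cvg_harmonic).
  exact: sqrt_continuous.
Qed.

Lemma max_meeting_time_ge {R : realType} {T : finType} (m : T -> T -> \bar R) u v :
  (m u v <= max_meeting_time m)%E.
Proof. exact: (le_bigmax _ (fun p : T * T => m p.1 p.2) (u, v)). Qed.

Lemma mean_meeting_time_le_max {R : realType} {T : finType} (w : T -> R)
    (m : T -> T -> \bar R) (B : R) :
  (forall u, 0 <= w u) -> \sum_u w u = 1 ->
  (forall u v, (0 <= m u v <= B%:E)%E) ->
  (mean_meeting_time w m <= max_meeting_time m <= B%:E)%E.
Proof.
move=> w0 w1 mB; apply/andP; split; last first.
  apply/bigmax_leP; split; first exact: leNye.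
  by move=> [u v] _; have /andP[] := mB u v.
(* The maximum starts from [-oo]. The weights sum to 1, so [T] is inhabited and the maximum is not
   that default value. *)
have [u0 _|T0] := pickP (fun _ : T => true); last first.
  by move: w1; rewrite big1 => [/eqP|u]; [rewrite eq_sym oner_eq0|have := T0 u].
case: (max_meeting_time m) (max_meeting_time_ge m) => [M||] hM; first last.
- have := hM u0 u0; rewrite leeNy_eq => /eqP m0.
  by have := mB u0 u0; rewrite m0.
- exact: leey.
rewrite -[M]mul1r -[1]w1 /mean_meeting_time.
have -> : ((\sum_u w u) * M)%:E = (\sum_u \sum_v (w u * w v)%:E * M%:E)%E.
  under [RHS]eq_bigr => u _.
    under eq_bigr do rewrite -EFinM.
    rewrite sumEFin -mulr_suml -mulr_sumr w1 mulr1; over.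
  by rewrite sumEFin mulr_suml.
apply: lee_sum => u _; apply: lee_sum => v _.
by rewrite lee_wpmul2l// lee_fin mulr_ge0.
Qed.

Theorem theorem1p3 (R : realType) (V : finType)
    (P : V -> V -> R) (pi : V -> R)
    (P_stochastic : stochastic P) (P_mixing : mixing P)
    (pi_stationary : stationary P pi)
    (d : measure_display) (Omega : measurableType d) (Pr : probability Omega R)
    (X Y : forall n : nat, block P pi n -> block P pi n ->
           nat -> Omega -> block P pi n)
    (XY_walkers : forall (n : nat) (u v : block P pi n),
       independent_walkers Pr (@block_trans R V P pi n) u v (X n u v) (Y n u v)) :
  let m := fun (n : nat) (u v : block P pi n) =>
    expected_meeting_time Pr (X n u v) (Y n u v) in
  ((n.+1%:R^-1)%:E * lne (max_meeting_time (m n)))%E @[n --> \oo]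
    --> (Lrate P)%:E
  /\
  ((n.+1%:R^-1)%:E
     * lne (mean_meeting_time (@block_stationary R V P pi n) (m n)))%E
    @[n --> \oo] --> (Lrate P)%:E.
Proof.
move=> m; have [pi0 pi1 _] := pi_stationary.
have [v0 _|V0] := pickP (fun _ : V => true); last first.
  by move: pi1; rewrite big1 => [/eqP|u]; [rewrite eq_sym oner_eq0|have := V0 u].
have [lam [lam0 ->] [c [C [c0 C0 q_growth]]]] :=
  path_sum_growth P_stochastic P_mixing v0.
have [k [delta delta0 pair_delta]] := mixing_pair_step P_mixing.
pose Q u v := P u v ^+ 2.
have Q0 u v : 0 <= Q u v by exact: sqr_ge0.
have blockS n := block_trans_stochastic P_stochastic pi_stationary n.
(* Windows have length [k + n + 1 <= (k + 1) * (n + 1)] and success probability at least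
   [delta * c * lam ^+ n]; the quotient is at most [D * (n + 1) / lam ^+ n]. *)
pose D : R := k.+1%:R / (delta * c).
have D0 : 0 < D by rewrite divr_gt0// mulr_gt0.
have m_le n u v : (m n u v <= (D * n.+1%:R / lam ^+ n)%:E)%E.
  pose p := delta * (c * lam ^+ n).
  have p0 : 0 < p by rewrite !mulr_gt0// exprn_gt0.
  have meet_p a b : p <= meet_at (@block_trans R V P pi n) (k + n) a b.
    apply: le_trans (meet_at_last P_stochastic pi_stationary k a b).
    apply: le_trans (pair_delta _ _ _ _); last first.
      by move=> x y; case: eqP => // _; exact: path_sum_ge0.
    under eq_bigr do rewrite eqxx.
    by rewrite ler_pM2l//; have /andP[] := q_growth n.
  apply: (expected_meeting_time_le (blockS n) (XY_walkers n u v)) => M.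
  apply: (le_trans (sum_no_meet_le (blockS n) meet_p M u v p0)).
  have -> : D * n.+1%:R / lam ^+ n = k.+1%:R * n.+1%:R / p.
    by rewrite /D /p; field; rewrite !gt_eqF// exprn_gt0.
  rewrite ler_pM2r ?invr_gt0// -natrM ler_nat; lia.
have m_ge0 n u v : (0 <= m n u v)%E.
  apply: le_trans (expected_meeting_time_ge (blockS n) (XY_walkers n u v) 0).
  by rewrite big_ord0.
have mean_max n := mean_meeting_time_le_max
  (fun u => word_measure_ge0 P_stochastic pi_stationary (val u))
  (sum_block_stationary P_stochastic pi_stationary n)
  (fun u v => introT andP (conj (m_ge0 n u v) (m_le n u v))).
have mean_ge n : (((4 * C)^-1 / lam ^+ n)%:E <=
    mean_meeting_time (@block_stationary R V P pi n) (m n))%E.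
  have [t] := mean_sum_no_meet_ge (blockS n)
    (fun u => word_measure_ge0 P_stochastic pi_stationary (val u))
    (sum_block_stationary P_stochastic pi_stationary n)
    (@block_stationaryP _ _ _ _ P_stochastic pi_stationary n).
  set S := \sum_u _ ^+ 2 => mean_t.
  have S_le : S <= C * lam ^+ n.
    rewrite /S sum_block_stationary_sqr//.
    apply: (@le_trans _ _ (\sum_a path_sum Q n a)); last by have /andP[] := q_growth n.
    apply: ler_sum => a _; rewrite ler_piMl ?path_sum_ge0// expr_le1//.
    by rewrite -pi1 (bigD1 a)//= lerDl sumr_ge0.
  apply: (@le_trans _ _ (\sum_u \sum_v block_stationary u * block_stationary v *
    \sum_(i < t.+1) no_meet (@block_trans R V P pi n) i u v)%:E).
    rewrite lee_fin; apply: le_trans mean_t.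
    have S0 : 0 < S by exact: sum_sqr_gt0 (sum_block_stationary _ _ n).
    rewrite -invfM lef_pV2 ?posrE ?mulr_gt0// ?exprn_gt0//.
    by rewrite -mulrA ler_pM2l.
  rewrite /mean_meeting_time -sumEFin; apply: lee_sum => u _.
  rewrite -sumEFin; apply: lee_sum => v _.
  rewrite EFinM lee_wpmul2l//.
    by rewrite lee_fin mulr_ge0// (word_measure_ge0 P_stochastic pi_stationary).
  exact: (expected_meeting_time_ge (blockS n) (XY_walkers n u v)).
have C4 : 0 < (4 * C)^-1 by rewrite invr_gt0 mulr_gt0.
(* Both quantities lie between the same two bounds, because the mean is at most the maximum. *)
split; apply: (growth_rate lam0 C4 D0) => n.
  have /andP[h1 h2] := mean_max n.
  by rewrite h2 andbT (le_trans (mean_ge n)).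
have /andP[h1 h2] := mean_max n.
by rewrite mean_ge (le_trans h1).
Qed.
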